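(* The structural completion of the logic of $\mathbf{RN}$ is hereditarily structurally complete.
   Context: $\mathbf{RN}$ is the Rieger–Nishimura ladder, i.e. the infinite cyclic (one-generated) Heyting algebra, equivalently the free Heyting algebra on one generator. Its logic is the set $L(\mathbf{RN})$ of all formulas (in connectives $\wedge,\vee,\to,\neg$ over a countably infinite set of variables) taking value $\mathbf{1}$ under every valuation in $\mathbf{RN}$. A rule is a pair $\Gamma/A$ with $\Gamma$ a finite (possibly empty) set of formulas and $A$ a formula. A deductive system is a pair $S=\langle Ax,R\rangle$ of a nonempty set of formulas and a nonempty set of rules. For finite $\Gamma$, $\Gamma\vdash_S A$ means there is a sequence $B_1,\dots,B_n=A$ where each $B_i$ is in $\Gamma$, or is a substitution instance of a formula of $Ax$, or there is a substitution instance $\Delta/B_i$ of a rule in $R$ with $\Delta\subseteq\{B_1,\dots,B_{i-1}\}$. $L(S)=\{A:\ \vdash_S A\}$. $S'$ is a deductive extension of $S$ if $\vdash_S\subseteq\vdash_{S'}$. A rule $r$ is admissible in $S=\langle Ax,R\rangle$ if $L(\langle Ax,R\cup\{r\}\rangle)=L(S)$; $\Gamma/A$ is derivable in $S$ if $\Gamma\vdash_S A$. $S$ is structurally complete if every rule admissible in $S$ is derivable in $S$; it is hereditarily structurally complete if it is structurally complete and every deductive extension of it is structurally complete. The structural completion of a logic $L$ (a set of formulas extending intuitionistic logic, closed under substitution and Modus Ponens) is the deductive system $\langle L,\widetilde{R}\rangle$, where $\widetilde{R}$ is the set of all rules admissible in $L$, i.e. of all rules $\Gamma/A$ such that for every substitution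 $\sigma$, $\sigma(\Gamma)\subseteq L$ implies $\sigma(A)\in L$. *)

(* Defs.v *)
From HB Require Import structures.
From mathcomp Require Import all_boot all_order zify.

Set Implicit Arguments.
Unset Strict Implicit.
Unset Printing Implicit Defensive.

Import Order.TTheory.
Local Open Scope order_scope.

Inductive form : Type :=
| Var of nat
| And of form & form
| Or of form & form
| Imp of form & form
| Neg of form.

Definition form_eq_dec (A B : form) : {A = B} + {A <> B}.
Proof. decide equality; exact: PeanoNat.Nat.eq_dec. Defined.

HB.instance Definition _ := hasDecEq.Build form (compareP form_eq_dec).

Fixpoint subst (s : nat -> form) (A : form) : form :=
  match A with
  | Var i => s i
  | And B C => And (subst s B) (subst s C)
  | Or B C => Or (subst s B) (subst s C)
  | Imp B C => Imp (subst s B) (subst s C)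
  | Neg B => Neg (subst s B)
  end.

(* The list of premises stands for the finite set of its members. *)
Record rule : Type := Rule { premises : seq form; conclusion : form }.

Definition rule_subst (s : nat -> form) (r : rule) : rule :=
  Rule (map (subst s) (premises r)) (subst s (conclusion r)).

Record system : Type := System {
  axioms : form -> Prop;
  rules : rule -> Prop;
  axioms_neq0 : exists A, axioms A;
  rules_neq0 : exists r, rules r
}.

Definition justified (S : system) (G Bs : seq form) (B : form) : Prop :=
  [\/ B \in G,
      exists A s, axioms S A /\ B = subst s A
    | exists r s, [/\ rules S r,
        {subset premises (rule_subst s r) <= Bs}
      & B = conclusion (rule_subst s r)]].

Definition is_derivation (S : system) (G Bs : seq form) : Prop :=
  forall Bs1 B Bs2, Bs = Bs1 ++ B :: Bs2 -> justified S G Bs1 B.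

Definition derives (S : system) (G : seq form) (A : form) : Prop :=
  exists Bs, is_derivation S G (rcons Bs A).

Definition theorems (S : system) (A : form) : Prop := derives S [::] A.

Definition deductive_extension (S S' : system) : Prop :=
  forall G A, derives S G A -> derives S' G A.

Lemma add_rule_neq0 (S : system) (r : rule) :
  exists r', rules S r' \/ r' = r.
Proof. by exists r; right. Qed.

Definition add_rule (S : system) (r : rule) : system :=
  System (axioms_neq0 S) (add_rule_neq0 S r).

Definition admissible (S : system) (r : rule) : Prop :=
  forall A, theorems (add_rule S r) A <-> theorems S A.

Definition derivable (S : system) (r : rule) : Prop :=
  derives S (premises r) (conclusion r).

Definition structurally_complete (S : system) : Prop :=
  forall r, admissible S r -> derivable S r.

Definition hereditarily_structurally_complete (S : system) : Prop :=
  structurally_complete S /\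
  forall S', deductive_extension S S' -> structurally_complete S'.

Inductive IPC : form -> Prop :=
| IPC_K A B : IPC (Imp A (Imp B A))
| IPC_S A B C :
    IPC (Imp (Imp A (Imp B C)) (Imp (Imp A B) (Imp A C)))
| IPC_andl A B : IPC (Imp (And A B) A)
| IPC_andr A B : IPC (Imp (And A B) B)
| IPC_pair A B : IPC (Imp A (Imp B (And A B)))
| IPC_orl A B : IPC (Imp A (Or A B))
| IPC_orr A B : IPC (Imp B (Or A B))
| IPC_case A B C :
    IPC (Imp (Imp A C) (Imp (Imp B C) (Imp (Or A B) C)))
| IPC_negI A B : IPC (Imp (Imp A B) (Imp (Imp A (Neg B)) (Neg A)))
| IPC_negE A B : IPC (Imp (Neg A) (Imp A B))
| IPC_mp A B : IPC A -> IPC (Imp A B) -> IPC B.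

Record logic : Type := Logic {
  in_logic :> form -> Prop;
  logic_IPC : forall A, IPC A -> in_logic A;
  logic_subst : forall s A, in_logic A -> in_logic (subst s A);
  logic_mp : forall A B, in_logic A -> in_logic (Imp A B) -> in_logic B
}.

Definition logic_admissible (L : logic) (r : rule) : Prop :=
  forall s, (forall A, A \in premises (rule_subst s r) -> L A) ->
    L (conclusion (rule_subst s r)).

Lemma logic_neq0 (L : logic) : exists A, L A.
Proof. by exists (Imp (Var 0) (Imp (Var 0) (Var 0))); apply/logic_IPC/IPC_K. Qed.

Lemma logic_admissible_neq0 (L : logic) : exists r, logic_admissible L r.
Proof.
exists (Rule [:: Var 0] (Var 0)) => s; apply; exact: mem_head.
Qed.

Definition structural_completion (L : logic) : system :=
  System (logic_neq0 L) (logic_admissible_neq0 L).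

HB.mixin Record isHeyting d T of Order.TBLattice d T := {
  himp : T -> T -> T;
  le_himp : forall x y z : T, (x <= himp y z) = (x `&` y <= z)
}.

#[short(type="heytingType")]
HB.structure Definition Heyting d := {T of isHeyting d T & Order.TBLattice d T}.

Section HeytingLogic.
Variables (d : Order.disp_t) (H : heytingType d).
Implicit Types (a b c x : H) (v : nat -> H).

Fixpoint eval v (A : form) : H :=
  match A with
  | Var i => v i
  | And B C => eval v B `&` eval v C
  | Or B C => eval v B `|` eval v C
  | Imp B C => himp (eval v B) (eval v C)
  | Neg B => himp (eval v B) \bot
  end.

Definition valid (A : form) : Prop := forall v, eval v A = \top.

Definition generates (G : H -> Prop) : Prop :=
  forall P : H -> Prop,
    (forall x, G x -> P x) -> P \bot -> P \top ->
    (forall x y, P x -> P y -> P (x `&` y)) ->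
    (forall x y, P x -> P y -> P (x `|` y)) ->
    (forall x y, P x -> P y -> P (himp x y)) ->
    forall x, P x.

Definition cyclic : Prop := exists g : H, generates (fun x => x = g).

Lemma himp_eq1 a b : (himp a b == \top) = (a <= b).
Proof. by rewrite -le1x le_himp meet1x. Qed.

Lemma himp_mp a b x : x <= himp a b -> x <= a -> x <= b.
Proof. by rewrite le_himp => + xa; rewrite meet_l. Qed.

Lemma valid_IPC A : IPC A -> valid A.
Proof.
have le_axiom x : (forall y : H, y <= x) -> x = \top.
  by move=> /(_ \top); rewrite le1x => /eqP.
elim=> {A}
  [A B|A B C|A B|A B|A B|A B|A B|A B C|A B|A B|A B _ vA _ vAB] v /=;
  try (apply: le_axiom => y; rewrite !le_himp).
- by rewrite (le_trans (leIl _ _)) ?leIr.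
- set a := eval v A; set b := eval v B; set c := eval v C.
  set w := _ `&` a.
  have wa : w <= a by apply: leIr.
  have wab : w <= himp a b.
    by rewrite (le_trans (leIl _ _)) ?leIr.
  have wabc : w <= himp a (himp b c).
    by rewrite (le_trans (leIl _ _)) // (le_trans (leIl _ _)) ?leIr.
  by apply: (himp_mp (a := b)); [apply: himp_mp wabc wa | apply: himp_mp wab wa].
- by rewrite (le_trans (leIr _ _)) ?leIl.
- by rewrite (le_trans (leIr _ _)) ?leIr.
- by rewrite lexI leIr (le_trans (leIl _ _)) ?leIr.
- by rewrite (le_trans (leIr _ _)) ?leUl.
- by rewrite (le_trans (leIr _ _)) ?leUr.
- set a := eval v A; set b := eval v B; set c := eval v C.
  set u := y `&` _ `&` _.
  suff: a `|` b <= himp u c by rewrite le_himp meetC.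
  have ua : u <= himp a c by rewrite (le_trans (leIl _ _)) ?leIr.
  have ub : u <= himp b c by rewrite leIr.
  by rewrite leUx; apply/andP; split; rewrite le_himp meetC -le_himp.
- set a := eval v A; set b := eval v B.
  set w := _ `&` a.
  have wa : w <= a by apply: leIr.
  have wnb : w <= himp a (himp b \bot).
    by rewrite (le_trans (leIl _ _)) ?leIr.
  have wb : w <= himp a b.
    by rewrite (le_trans (leIl _ _)) // (le_trans (leIl _ _)) ?leIr.
  by apply: (himp_mp (a := b)); [apply: himp_mp wnb wa | apply: himp_mp wb wa].
- set a := eval v A; set b := eval v B.
  set w := _ `&` a.
  have wa : w <= a by apply: leIr.
  have wna : w <= himp a \bot by rewrite (le_trans (leIl _ _)) ?leIr.
  by apply: le_trans (himp_mp wna wa) _; apply: le0x.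
apply/eqP; rewrite -le1x -(vA v) -himp_eq1.
by rewrite -[X in X == _]/(eval v (Imp A B)) vAB.
Qed.

Lemma eval_subst v s A : eval v (subst s A) = eval (fun i => eval v (s i)) A.
Proof. by elim: A => //= [A -> B ->|A -> B ->|A -> B ->|A ->]. Qed.

Lemma valid_subst s A : valid A -> valid (subst s A).
Proof. by move=> vA v; rewrite eval_subst. Qed.

Lemma valid_mp A B : valid A -> valid (Imp A B) -> valid B.
Proof.
move=> vA vAB v; apply/eqP; rewrite -le1x -(vA v) -himp_eq1.
by apply/eqP; apply: vAB.
Qed.

Definition logic_of : logic := Logic valid_IPC valid_subst valid_mp.

End HeytingLogic.

(* The ladder is the algebra of upward closed subsets of the poset on nat in
   which the points above k are k itself and all j with j + 2 <= k.  These
   subsets are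
     [RNseg n] = {0, ..., n-1},
     [RNgap n] = {0, ..., n-1} together with n+1,
     [RNtop]   = the set of all points,
   and they are ordered by inclusion (see [rn_mem_upset], [rn_mem_surj] and
   [rn_leP]; by [rn_infinite] and [rn_cyclic] it is the infinite cyclic Heyting
   algebra). *)
Inductive rn : Type := RNseg of nat | RNgap of nat | RNtop.

Definition rn_code (x : rn) : option (nat + nat) :=
  match x with
  | RNseg n => Some (inl n) | RNgap n => Some (inr n) | RNtop => None
  end.

Definition rn_decode (c : option (nat + nat)) : rn :=
  match c with
  | Some (inl n) => RNseg n | Some (inr n) => RNgap n | None => RNtop
  end.

Lemma rn_codeK : cancel rn_code rn_decode. Proof. by case. Qed.

HB.instance Definition _ := Countable.copy rn (can_type rn_codeK).

Definition rn_mem (x : rn) (k : nat) : bool :=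
  match x with
  | RNseg n => (k < n)%N
  | RNgap n => (k < n)%N || (k == n.+1)
  | RNtop => true
  end.

Definition rn_le (x y : rn) : bool :=
  match x, y with
  | _, RNtop => true
  | RNtop, _ => false
  | RNseg m, RNseg n => (m <= n)%N
  | RNseg m, RNgap n => (m <= n)%N
  | RNgap m, RNseg n => (m.+2 <= n)%N
  | RNgap m, RNgap n => (m == n) || (m.+2 <= n)%N
  end.

Definition rn_meet (x y : rn) : rn :=
  if rn_le x y then x else if rn_le y x then y else
  match x, y with
  | RNseg m, RNgap n => RNseg (minn m n)
  | RNgap m, RNseg n => RNseg (minn m n)
  | RNgap m, RNgap n => RNseg (minn m n)
  | _, _ => RNtop
  end.

Definition rn_join (x y : rn) : rn :=
  if rn_le x y then y else if rn_le y x then x else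
  match x, y with
  | RNseg m, RNgap n => RNseg (maxn m n.+2)
  | RNgap m, RNseg n => RNseg (maxn m.+2 n)
  | RNgap m, RNgap n => RNseg (maxn m n).+2
  | _, _ => RNtop
  end.

Definition rn_imp (x y : rn) : rn :=
  if rn_le x y then RNtop else
  match x, y with
  | RNseg m, RNseg n => if m == n.+1 then RNgap n else RNseg n
  | RNgap m, RNseg n =>
      if (m <= n)%N then RNgap m.+1
      else if m == n.+1 then RNgap n else RNseg n
  | _, _ => y
  end.

Ltac rn_cases := repeat (case: ifP => ? //=); try lia.

Lemma rn_le_refl : reflexive rn_le.
Proof. by case=> //= n; lia. Qed.

Lemma rn_le_anti : antisymmetric rn_le.
Proof.
by case=> [m|m|] [n|n|] //=; try lia; move=> ?; congr (_ _); lia.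
Qed.

Lemma rn_le_trans : transitive rn_le.
Proof. by case=> [m|m|] [n|n|] [p|p|] //=; lia. Qed.

Lemma rn_display : Order.disp_t. Proof. exact: Order.Disp tt tt. Qed.

HB.instance Definition _ :=
  Order.Le_isPOrder.Build rn_display rn rn_le_refl rn_le_anti rn_le_trans.

Lemma rn_lexI (x y z : rn) : rn_le x (rn_meet y z) = rn_le x y && rn_le x z.
Proof. by rewrite /rn_meet; case: x y z => [m|m|] [n|n|] [p|p|] //=; rn_cases. Qed.

Lemma rn_leUx (x y z : rn) : rn_le (rn_join x y) z = rn_le x z && rn_le y z.
Proof. by rewrite /rn_join; case: x y z => [m|m|] [n|n|] [p|p|] //=; rn_cases. Qed.

Lemma rn_le0x (x : rn) : rn_le (RNseg 0) x. Proof. by case: x. Qed.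

Lemma rn_lex1 (x : rn) : rn_le x RNtop. Proof. by case: x. Qed.

HB.instance Definition _ :=
  Order.POrder_isMeetSemilattice.Build rn_display rn rn_lexI.
HB.instance Definition _ :=
  Order.POrder_isJoinSemilattice.Build rn_display rn rn_leUx.
HB.instance Definition _ := Order.hasBottom.Build rn_display rn rn_le0x.
HB.instance Definition _ := Order.hasTop.Build rn_display rn rn_lex1.

Lemma rn_le_imp (x y z : rn) : rn_le x (rn_imp y z) = rn_le (rn_meet x y) z.
Proof.
rewrite /rn_meet /rn_imp.
by case: x y z => [m|m|] [n|n|] [p|p|] //=; rn_cases.
Qed.

HB.instance Definition _ := isHeyting.Build rn_display rn rn_le_imp.

Lemma rn_leP (x y : rn) : x <= y <-> (forall k, rn_mem x k -> rn_mem y k).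
Proof.
rewrite -[x <= y]/(rn_le x y); split.
  by case: x y => [m|m|] [n|n|] //= + k; lia.
case: x y => [m|m|] [n|n|] //= xy.
- by have := xy m.-1; lia.
- by have := xy m.-1; have := xy n; lia.
- by have := xy m.+1; lia.
- by have := xy m.+1; have := xy n; lia.
- by have := xy n.+2; lia.
- by have := xy n.+2; lia.
Qed.

Lemma rn_mem_upset (x : rn) (j k : nat) :
  (j.+2 <= k)%N -> rn_mem x k -> rn_mem x j.
Proof. by case: x => [n|n|] //=; lia. Qed.

Lemma rn_mem_surj (U : pred nat) :
  (forall j k, (j.+2 <= k)%N -> U k -> U j) ->
  (exists k, ~~ U k) -> exists x, rn_mem x =1 U.
Proof.
move=> upU exU; case: (ex_minnP exU) => n Un minn.
have ltU k : (k < n)%N -> U k.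
  by move=> kn; apply/negPn/negP => /minn; lia.
have gtU k : (n.+2 <= k)%N -> U k = false.
  by move=> nk; apply/negP => /(upU _ _ nk) Un'; rewrite Un' in Un.
have split_k k : [\/ (k < n)%N, k = n, k = n.+1 | (n.+2 <= k)%N].
  case: (ltngtP k n) => [|nk|]; [by constructor 1 | | by constructor 2].
  by case: (ltngtP k n.+1) => ?; [lia | constructor 4 | constructor 3].
have Unf : U n = false by apply: negbTE.
case US: (U n.+1); [exists (RNgap n) | exists (RNseg n)] => k /=;
  by case: (split_k k) => [/[dup] /ltU -> | -> | -> | /[dup] /gtU ->];
    rewrite ?US ?Unf; lia.
Qed.

Lemma rn_infinite : injective RNseg.
Proof. by move=> m n []. Qed.

Lemma rn_gapE n : RNgap n = himp (RNseg n.+1) (RNseg n).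
Proof. by rewrite /himp /= /rn_imp /= ltnn eqxx. Qed.

Lemma rn_segE n : RNseg n.+2 = RNseg n.+1 `|` RNgap n.
Proof.
rewrite /Order.join /= /rn_join /= ltnn ifF; last by lia.
by congr RNseg; lia.
Qed.

Lemma rn_cyclic : cyclic rn.
Proof.
exists (RNseg 1) => P Pg P0 P1 _ PU Pimp.
have Pseg n : P (RNseg n) /\ P (RNseg n.+1).
  elim: n => [|n [Pn PSn]]; first by split; last exact: Pg.
  by split=> //; rewrite rn_segE; apply: PU => //; rewrite rn_gapE; apply: Pimp.
case=> [n|n|]; [by case: (Pseg n) | | exact: P1].
by rewrite rn_gapE; case: (Pseg n) => *; apply: Pimp.
Qed.

(* Main.v *)
(** A rule valid in [RN] is admissible for the logic of [RN], so an extension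
    [S] of the structural completion derives all of them.  Let [G / A] be
    admissible in [S].  It is enough to find finitely many theorems of [S] that
    together with [G] entail [A] in [RN].

    Given a valuation [v] of [n] variables in [RN], collapse the ladder as far
    as [v] allows.  What remains is a linear sum of one-point and two-point
    antichains, finished by a single point or by a copy of the whole ladder.
    Its subalgebra of [RN] is projective: a bottom [b] and an arbitrary [y >= b]
    are corrected to generators of the next summand by [y \/ (y -> b)] (dense
    relative to [b]), by [(y -> b) -> b] (regular relative to [b]), or by
    nothing for the ladder, and [v] is built from the corrected generators.
    This gives a substitution [s] such that whatever [v] satisfies becomes valid
    in [RN]; hence if [v] satisfies [G] then [s G], and by admissibility [s A],
    consist of theorems of [S], while [s A] fails at [v] whenever [A] does.
    The variables that cut deep into a final ladder do not take part in choosing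
    the generators, so only finitely many shapes occur for a given [n], and one
    [s A] refutes every valuation that refutes [A] and has the same shape. *)

From Stdlib Require Import Classical.
From HB Require Import structures.
From mathcomp Require Import all_boot all_order zify.
Require Import Defs.

Set Implicit Arguments.
Unset Strict Implicit.
Unset Printing Implicit Defensive.

Import Order.TTheory.

(** * Derivations *)

Lemma is_derivation_cat S G Bs1 Bs2 :
  is_derivation S G Bs1 -> is_derivation S G Bs2 ->
  is_derivation S G (Bs1 ++ Bs2).
Proof.
move=> d1; elim/last_ind: Bs2 => [|Bs2 B IH] d2; first by rewrite cats0.
have d2' : is_derivation S G Bs2.
  by move=> Ds D Es e; apply: (d2 _ _ (rcons Es B)); rewrite e rcons_cat.
have jB : justified S G (Bs1 ++ Bs2) B.
  have := d2 Bs2 B [::]; rewrite cats1 => /(_ erefl).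
  case=> [GB|[A [s [AA ->]]]|[r [s [rr sub ->]]]]; [exact: Or31| |].
    by apply: Or32; exists A, s.
  by apply: Or33; exists r, s; split=> // x /sub; rewrite mem_cat orbC => ->.
move=> Ds D Es; rewrite -rcons_cat; case/lastP: Es => [|Es E].
  by rewrite cats1 => /rcons_inj [<- <-].
by rewrite -rcons_cons -rcons_cat => /rcons_inj [+ _]; apply: IH.
Qed.

Lemma derives_all S G (D : seq form) :
  (forall B, B \in D -> derives S G B) ->
  exists2 Bs, is_derivation S G Bs & {subset D <= Bs}.
Proof.
elim: D => [|A D IH] dD; first by exists [::] => // -[].
have [|Bs dBs sub] := IH; first by move=> B BD; apply: dD; rewrite inE BD orbT.
have [|Es dEs] := dD A; first exact: mem_head.
exists (rcons Es A ++ Bs); first exact: is_derivation_cat.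
move=> B; rewrite inE mem_cat mem_rcons => /predU1P [->|/sub ->].
  by rewrite mem_head.
by rewrite orbT.
Qed.

Lemma derives_justified S G (D : seq form) A :
  (forall B, B \in D -> derives S G B) -> justified S G D A -> derives S G A.
Proof.
move=> /derives_all [Bs dBs sub] jA; exists Bs => Ds B Es.
case/lastP: Es => [|Es E].
  rewrite cats1 => /rcons_inj [<- <-].
  case: jA => [GA|[C [s [AC ->]]]|[r [s [rr subr ->]]]]; [exact: Or31| |].
    by apply: Or32; exists C, s.
  by apply: Or33; exists r, s; split=> // x /subr /sub.
by rewrite -rcons_cons -rcons_cat => /rcons_inj [+ _]; apply: dBs.
Qed.

Lemma derives_cut S G (D : seq form) A :
  (forall B, B \in D -> derives S G B) -> derives S D A -> derives S G A.
Proof.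
move=> dD [Bs dBs].
suff all_d n : forall Es, size Es <= n -> is_derivation S D Es ->
    forall B, B \in Es -> derives S G B.
  by apply: (all_d _ (rcons Bs A) (leqnn _)); rewrite ?mem_rcons ?mem_head.
elim: n => [|n IH] Es; first by case: Es.
case/lastP: Es => [//|Es E]; rewrite size_rcons ltnS => sz dE.
have dEs : is_derivation S D Es.
  by move=> Ds B Fs e; apply: (dE _ _ (rcons Fs E)); rewrite e rcons_cat.
move=> B; rewrite mem_rcons inE => /predU1P [->|]; last exact: IH.
have := dE Es E [::]; rewrite cats1 => /(_ erefl).
case=> [/dD //|[C [s [AC ->]]]|[r [s [rr sub ->]]]].
  by apply: (@derives_justified _ _ [::]) => //; apply: Or32; exists C, s.
apply: (@derives_justified _ _ Es); first exact: IH.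
by apply: Or33; exists r, s.
Qed.

Lemma derives_rule S G r s :
  rules S r ->
  (forall B, B \in premises (rule_subst s r) -> derives S G B) ->
  derives S G (conclusion (rule_subst s r)).
Proof.
by move=> rr d; apply: (derives_justified d); apply: Or33; exists r, s; split.
Qed.

Lemma subst_Var A : subst Var A = A.
Proof. by elim: A => //= [A -> B ->|A -> B ->|A -> B ->|A ->]. Qed.

Lemma derives_premise S (G : seq form) A : A \in G -> derives S G A.
Proof.
by move=> GA; apply: (@derives_justified _ _ [::]) => //; apply: Or31.
Qed.

Lemma admissible_subst S r s :
  admissible S r ->
  (forall B, B \in premises (rule_subst s r) -> theorems S B) ->
  theorems S (conclusion (rule_subst s r)).
Proof.
move=> adm thB; apply/adm; apply: derives_rule; first by right.
by move=> B /thB thSB; apply/adm.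
Qed.

Definition holds (v : nat -> rn) A := eval v A = RNtop.

(** Such a rule is itself a rule of the completion: evaluating its instance under [s] at [v] is
    evaluating the rule at the valuation sending [i] to the value of [s i]. *)
Lemma valid_rule_derivable (G : seq form) A :
  (forall v, (forall B, B \in G -> holds v B) -> holds v A) ->
  derives (structural_completion (logic_of rn)) G A.
Proof.
move=> vGA; rewrite -[A]subst_Var.
apply: (@derives_rule (structural_completion _) G (Rule G A) Var) => /=.
  move=> s /= sG v; rewrite eval_subst; apply: vGA => B GB.
  by have := sG _ (map_f _ GB) v; rewrite eval_subst.
move=> B /mapP [D GD ->]; rewrite subst_Var; exact: derives_premise.
Qed.

(** * Forcing on the ladder *)

Definition above (k j : nat) : bool := (j == k) || (j.+2 <= k).

Definition force (v : nat -> rn) A k : bool := rn_mem (eval v A) k.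

Definition principal (k : nat) : rn := if k is j.+1 then RNgap j else RNseg 1.

Lemma mem_principal k j : rn_mem (principal k) j = above k j.
Proof. by rewrite /above; case: k => [|k] /=; lia. Qed.

Lemma principal_le k (x : rn) : (principal k <= x)%O = rn_mem x k.
Proof.
rewrite -[(_ <= _)%O]/(rn_le _ x).
by case: k x => [|k] [m|m|] //=; lia.
Qed.

Lemma mem_meet (x y : rn) k : rn_mem (x `&` y)%O k = rn_mem x k && rn_mem y k.
Proof. by rewrite -!principal_le lexI. Qed.

Lemma mem_join (x y : rn) k : rn_mem (x `|` y)%O k = rn_mem x k || rn_mem y k.
Proof.
rewrite -[(x `|` y)%O]/(rn_join x y) /rn_join.
by case: x y => [m|m|] [n|n|] //=; rn_cases; rewrite ?orbT //.
Qed.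

Lemma mem_himp (x y : rn) k :
  rn_mem (himp x y) k <-> forall j, above k j -> rn_mem x j -> rn_mem y j.
Proof.
rewrite -principal_le le_himp; split.
  by move=> /rn_leP le j kj xj; apply: le; rewrite mem_meet mem_principal kj.
move=> h; apply/rn_leP => j; rewrite mem_meet mem_principal => /andP [] .
exact: h.
Qed.

Lemma mem_inj (x y : rn) : rn_mem x =1 rn_mem y -> x = y.
Proof.
by move=> e; apply/le_anti/andP; split; apply/rn_leP => k; rewrite e.
Qed.

Ltac rn_ext :=
  apply: mem_inj => ?; rewrite !(mem_join, mem_meet) /=; lia.

Lemma rn_impE (x y : rn) : himp x y = rn_imp x y. Proof. by []. Qed.

Lemma rn_eqE m n :
  ((RNseg m == RNseg n) = (m == n)) * ((RNgap m == RNgap n) = (m == n)) *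
  ((RNseg m == RNgap n) = false) * ((RNgap m == RNseg n) = false).
Proof. by do !split; apply/eqP/eqP => [[]|->]. Qed.

(** The two gaps are pseudocomplements of each other over [RNseg c], hence regular relative to it;
    they serve as generators of two-point summands. *)
Lemma himp_gap c (t : bool) :
  himp (RNgap (c + t)) (RNseg c) = RNgap (c + ~~ t).
Proof.
rewrite rn_impE /rn_imp; case: t => /=; rewrite ?addn0 ?addn1;
  by do 3?[case: ifP => //=]; lia.
Qed.

Lemma above_refl k : above k k. Proof. by rewrite /above eqxx. Qed.

Lemma force_up v A k j : above k j -> force v A k -> force v A j.
Proof. by case/predU1P => [->//|]; apply: rn_mem_upset. Qed.

Lemma force_And v A B k : force v (And A B) k = force v A k && force v B k.
Proof. exact: mem_meet. Qed.

Lemma force_Or v A B k : force v (Or A B) k = force v A k || force v B k.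
Proof. exact: mem_join. Qed.

Lemma force_Imp v A B k :
  force v (Imp A B) k <-> forall j, above k j -> force v A j -> force v B j.
Proof. exact: mem_himp. Qed.

Lemma force_Neg v A k :
  force v (Neg A) k <-> forall j, above k j -> ~~ force v A j.
Proof.
rewrite /force /= mem_himp; split=> h j kj; last by move/negP: (h j kj).
by apply/negP => /(h j kj).
Qed.

Lemma not_force_Imp v A B k :
  ~~ force v (Imp A B) k ->
  exists2 j, above k j & force v A j && ~~ force v B j.
Proof.
move=> /negP nf; apply: NNPP => nex; apply: nf; apply/force_Imp => j kj fA.
by apply/negPn/negP => nB; apply: nex; exists j; rewrite // fA.
Qed.

Lemma holdsP v A : holds v A <-> forall k, force v A k.
Proof.
by rewrite /holds /force; split=> [->//|h]; apply: mem_inj => k; rewrite h.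
Qed.

(** * Linear sums of ladder pieces *)

(* The Rieger-Nishimura polynomials of [g] relative to the bottom [b]. *)
Fixpoint seg (b g : form) (n : nat) : form :=
  match n with
  | 0 => b
  | m.+1 => match m with
            | 0 => g
            | l.+1 => Or (seg b g m) (Imp (seg b g m) (seg b g l))
            end
  end.

Definition block_at v b g n k :=
  force v (seg b g n.+1) k && ~~ force v (seg b g n) k.

Definition fle A B := forall v k, force v A k -> force v B k.

Lemma fle_trans A B C : fle A B -> fle B C -> fle A C.
Proof. by move=> ab bc v k /ab /bc. Qed.

Lemma segSS b g n :
  seg b g n.+2 = Or (seg b g n.+1) (Imp (seg b g n.+1) (seg b g n)).
Proof. by []. Qed.

Section Block.
Variables b g : form.
Hypothesis bg : fle b g.

Lemma seg_leS n : fle (seg b g n) (seg b g n.+1).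
Proof.
case: n => [|n] //= v k.
by rewrite force_Or => ->.
Qed.

Lemma seg_le m n : m <= n -> fle (seg b g m) (seg b g n).
Proof.
move=> mn; rewrite -(subnK mn); elim: (n - m) => [|l IH] //.
exact: fle_trans IH (@seg_leS _).
Qed.

Variable v : nat -> rn.

Lemma block_exists m k :
  ~~ force v b k -> force v (seg b g m) k ->
  exists2 n, n < m & block_at v b g n k.
Proof.
move=> nb; elim: m => [|m IH]; first by rewrite /= (negbTE nb).
case fm: (force v (seg b g m) k) => h.
  by have [n nm ?] := IH fm; exists n; rewrite // ltnW.
by exists m; rewrite // /block_at h fm.
Qed.

(** Points strictly above a given one have smaller numbers. Once these force [seg b g m], a point
    failing [seg b g m.+1] forces the implication from it to [seg b g m]. *)
Lemma seg_exhaust k : exists m, force v (seg b g m) k.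
Proof.
suff [m h] : exists m, forall j, j <= k -> force v (seg b g m) j.
  by exists m; apply: h.
elim: k => [|k [m h]].
  exists 2 => j; rewrite leqn0 => /eqP ->.
  rewrite /= force_Or; case fg: (force v g 0) => //=.
  by apply/force_Imp => i; rewrite /above => /orP [/eqP ->|//]; rewrite fg.
exists m.+2 => j; rewrite leq_eqVlt => /predU1P [->|jk]; last first.
  by apply: (seg_le (leqW (leqnSn m))); apply: h.
rewrite segSS force_Or; case fg: (force v (seg b g m.+1) k.+1) => //.
by apply/force_Imp => i /predU1P [->|ik _]; [rewrite fg | apply: h; lia].
Qed.

Lemma block_force n k m : block_at v b g n k -> force v (seg b g m) k = (n < m).
Proof.
case/andP=> f nf; case: ltnP => [nm|mn]; first exact: (seg_le nm).
by apply/negbTE; apply: contra nf; apply: seg_le.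
Qed.

(** With [block_back], this makes the block number a p-morphism to the ladder. The case [n = m.+1]
    is excluded because a new point of block [n] forces the implication that block [m] refutes. *)
Lemma block_forth n m k j :
  block_at v b g n k -> block_at v b g m j -> above k j -> above n m.
Proof.
move=> bk bj kj; have := block_force n.+1 bk; rewrite ltnSn.
case: n bk => [|n] bk fk.
  have := force_up kj fk; rewrite (block_force _ bj).
  by rewrite /above; lia.
have := force_up kj fk; rewrite (block_force _ bj) => mn.
move: fk; rewrite segSS force_Or (block_force n.+1 bk) ltnn.
move=> /force_Imp /(_ j kj).
by rewrite !(block_force _ bj) /above; move: mn; lia.
Qed.

Lemma block_back m k :
  ~~ force v (seg b g m.+2) k -> exists2 j, above k j & block_at v b g m j.
Proof.
by rewrite segSS force_Or negb_or => /andP [_ /not_force_Imp].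
Qed.

End Block.

Notation data := (bool * nat * nat)%type.

(* The shape of a linear sum, read from the top summand downwards.  [End] is a
   single last point, [Ladder] a last copy of the whole ladder, and [Step two]
   a two-point (if [two]) or one-point antichain with further summands below.
   The data name the variables from which the generator is built. *)
Inductive code : Type :=
| End
| Ladder of data
| Step of bool & data & code.

Definition code_eq_dec (C D : code) : {C = D} + {C <> D}.
Proof.
by decide equality; apply: eq_comparable. Defined.

HB.instance Definition _ := hasDecEq.Build code (compareP code_eq_dec).

(** The disjunct [b] puts the value above the border. A meet is allowed because the generator needed
    may not be the value of a single variable; one variable is the case [p = q] without
    complement. *)
Definition raw (d : data) (b : form) : form :=
  let: (neg, p, q) := d in
  Or (And (if neg then Imp (Var p) b else Var p) (Var q)) b.

Definition step_gen (two : bool) (d : data) (b : form) : form :=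
  let y := raw d b in
  if two then Imp (Imp y b) b else Or y (Imp y b).

Definition next two d b := seg b (step_gen two d b) two.+1.

(* [k] is sent to the [n]-th point of the [i]-th summand; [b] is the border
   above which the previous summands lie. *)
Fixpoint at_loc (C : code) (b : form) (i n : nat) (v : nat -> rn) (k : nat)
    : bool :=
  match C with
  | End => [&& i == 0, n == 0 & ~~ force v b k]
  | Ladder d => (i == 0) && block_at v b (raw d b) n k
  | Step two d C' =>
      if i is i'.+1 then at_loc C' (next two d b) i' n v k
      else (n <= two) && block_at v b (step_gen two d b) n k
  end.

Fixpoint is_loc (C : code) (i n : nat) : bool :=
  match C with
  | End => (i == 0) && (n == 0)
  | Ladder _ => i == 0
  | Step two _ C' => if i is i'.+1 then is_loc C' i' n else n <= two
  end.

Lemma at_is_loc C b i n v k : at_loc C b i n v k -> is_loc C i n.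
Proof.
elim: C b i => [|d|two d C IH] b i /=.
- by case/and3P => -> ->.
- by case/andP.
- by case: i => [|i]; [case/andP | apply: IH].
Qed.

Lemma raw_ge d b : fle b (raw d b).
Proof. by case: d => [[neg p] q] v k; rewrite force_Or orbC => ->. Qed.

Lemma step_gen_ge two d b : fle b (step_gen two d b).
Proof.
rewrite /step_gen; case: two => v k fb.
  by apply/force_Imp => j kj _; apply: force_up kj fb.
by rewrite force_Or (raw_ge d fb).
Qed.

Lemma next_ge two d b : fle b (next two d b).
Proof. exact: (@seg_le _ _ (@step_gen_ge two d b) 0). Qed.

Lemma at_notin C b i n v k : at_loc C b i n v k -> ~~ force v b k.
Proof.
elim: C b i => [|d|two d C IH] b i /=.
- by case/and3P.
- case/andP=> _ bk; rewrite -[b]/(seg b (raw d b) 0).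
  by rewrite (block_force (@raw_ge d b) _ bk).
case: i => [|i]; last by move/IH; apply: contra; apply: next_ge.
case/andP => _ bk; rewrite -[b]/(seg b (step_gen two d b) 0).
by rewrite (block_force (@step_gen_ge two d b) _ bk).
Qed.

Lemma at_total C b v k : ~~ force v b k -> exists i n, at_loc C b i n v k.
Proof.
elim: C b => [|d|two d C IH] b nb /=.
- by exists 0, 0.
- have [m fm] := seg_exhaust (@raw_ge d b) v k.
  by have [n _ bn] := block_exists nb fm; exists 0, n.
case fn: (force v (next two d b) k); last first.
  by have [|i [n]] := IH (next two d b); [rewrite fn | exists i.+1, n].
by have [n nm bn] := block_exists nb fn; exists 0, n; rewrite -ltnS nm bn.
Qed.

(* Relative density of the generator of a one-point block and relative
   regularity of that of a two-point block give every point below the block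
   a point above it at each location of the block. *)
Lemma next_back two d b v k n :
  ~~ force v (next two d b) k -> n <= two ->
  exists2 j, above k j & block_at v b (step_gen two d b) n j.
Proof.
case: two n => -[|[|n]] //.
- by move=> nf _; apply: block_back.
- rewrite /next [seg _ _ _]/= force_Or negb_or => /andP [nf _] _.
  rewrite /= in nf; have [j kj /andP [fj nb]] := not_force_Imp nf.
  exists j => //; rewrite /block_at [seg _ _ 2]/= force_Or.
  have nI : ~~ force v (step_gen true d b) j.
    apply/negP => /force_Imp /(_ j (above_refl j) fj); by rewrite (negbTE nb).
  rewrite [seg _ _ 1]/= nI andbT; apply/orP; right.
  apply/force_Imp => i ji /force_Imp /(_ i (above_refl i)); apply.
  exact: force_up ji fj.
rewrite /next /= force_Or negb_or => /andP [ny nI] _.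
have [j kj /andP [fj nb]] := not_force_Imp nI.
by exists j => //; rewrite /block_at /= force_Or fj.
Qed.

(** Having the same location is a bisimulation between the points of two valuations outside [b].
    This carries invariance through implications. *)
Lemma at_bisim C b i n v k v' k' j' :
  at_loc C b i n v k -> at_loc C b i n v' k' ->
  above k' j' -> ~~ force v' b j' ->
  exists i' n' j, [/\ above k j, at_loc C b i' n' v j & at_loc C b i' n' v' j'].
Proof.
elim: C b i => [|d|two d C IH] b i /=.
- move=> ak _ _ nb; exists 0, 0, k; split=> //; first exact: above_refl.
  by case/and3P: ak.
- case/andP => _ bk /andP [_ bk'] kj' nb.
  have bg := @raw_ge d b.
  have [m fm] := seg_exhaust bg v' j'.
  have [n' _ bn'] := block_exists nb fm.
  have /predU1P [e|nn] := block_forth bg bk' bn' kj'.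
    by exists 0, n, k; rewrite bk -{1}e bn' above_refl; split.
  have [|j kj bj] := @block_back b (raw d b) v n' k.
    by rewrite (block_force bg _ bk) -leqNgt.
  by exists 0, n', j; rewrite bj bn'.
have bg := @step_gen_ge two d b.
case: i => [|i].
  case/andP=> nt bk /andP [_ bk'] kj' nb.
  have fj' : force v' (next two d b) j'.
    apply: (force_up kj'); rewrite /next (block_force bg _ bk'); lia.
  have [n' _ bn'] := block_exists nb fj'.
  have /orP aa := block_forth bg bk' bn' kj'.
  (* Both numbers are at most 1, so they are comparable in the ladder order only if equal: the
     summand is an antichain. *)
  have e : n' = n by case: aa => [/eqP //|]; case: (two) nt; lia.
  by exists 0, n, k; rewrite above_refl nt bk -{1}e bn'.
move=> ak ak' kj' nb; case fj': (force v' (next two d b) j').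
  have [n' n't bn'] := block_exists nb fj'.
  have [j kj bj] := next_back (at_notin ak) n't.
  by exists 0, n', j; rewrite bj bn' -ltnS n't.
have [|i' [n' [j [kj aj aj']]]] := IH _ _ ak ak' kj'; first by rewrite fj'.
by exists i'.+1, n', j.
Qed.

(** * Formulas whose truth depends only on the location *)

Definition invariant C b A := forall i n v k v' k',
  at_loc C b i n v k -> at_loc C b i n v' k' -> force v A k -> force v' A k'.

(* Points forcing [b] have no location, so invariance says nothing about them;
   the first condition settles their case. *)
Definition definable C b A := fle b A /\ invariant C b A.

Lemma invariant_And C b A B :
  invariant C b A -> invariant C b B -> invariant C b (And A B).
Proof.
move=> iA iB i n v k v' k' ak ak'; rewrite !force_And => /andP [fA fB].
by rewrite (iA _ _ _ _ _ _ ak ak' fA) (iB _ _ _ _ _ _ ak ak' fB).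
Qed.

Lemma invariant_Or C b A B :
  invariant C b A -> invariant C b B -> invariant C b (Or A B).
Proof.
move=> iA iB i n v k v' k' ak ak'; rewrite !force_Or => /orP [fA|fB].
  by rewrite (iA _ _ _ _ _ _ ak ak' fA).
by rewrite (iB _ _ _ _ _ _ ak ak' fB) orbT.
Qed.

Lemma definable_Imp C b A B :
  invariant C b A -> definable C b B -> definable C b (Imp A B).
Proof.
move=> iA [bB iB]; split.
  by move=> v k fb; apply/force_Imp => j kj _; apply/bB/(force_up kj).
move=> i n v k v' k' ak ak' /force_Imp f; apply/force_Imp => j' kj' fA.
case: (boolP (force v' b j')) => [/bB //|nb].
have [i' [n' [j [kj aj aj']]]] := at_bisim ak ak' kj' nb.
apply: (iB _ _ _ _ _ _ aj aj'); apply: f => //.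
exact: (iA _ _ _ _ _ _ aj' aj).
Qed.

Definition Top : form := Imp (Var 0) (Var 0).
Definition Bot : form := Neg Top.

Lemma force_Top v k : force v Top k.
Proof. exact/force_Imp. Qed.

Lemma force_Bot v k : force v Bot k = false.
Proof.
by apply/negP => /force_Neg /(_ k (above_refl k)); rewrite force_Top.
Qed.

Lemma definable_Top C b : definable C b Top.
Proof. by split=> [v k _|? ? ? ? v' k' _ _ _]; apply: force_Top. Qed.

Lemma definable_base C b : definable C b b.
Proof.
split=> // i n v k v' k' ak _ fb.
by have := at_notin ak; rewrite fb.
Qed.

Lemma invariant_Neg C A : invariant C Bot A -> invariant C Bot (Neg A).
Proof.
move=> iA i n v k v' k' ak ak' f.
have [_ h] := definable_Imp iA (definable_base C Bot).
have botE u B j : force u (Neg B) j <-> force u (Imp B Bot) j.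
  rewrite force_Neg force_Imp; split=> g l jl; first by move/negP: (g _ jl).
  by apply/negP => /(g _ jl); rewrite force_Bot.
by apply/botE; apply: h ak ak' _; apply/botE.
Qed.

Fixpoint vars_below n A : bool :=
  match A with
  | Var i => i < n
  | And B C | Or B C | Imp B C => vars_below n B && vars_below n C
  | Neg B => vars_below n B
  end.

Lemma vars_below_le m n A : m <= n -> vars_below m A -> vars_below n A.
Proof.
move=> mn; elim: A => //= [i im|A IA B IB|A IA B IB|A IA B IB];
  by [apply: leq_trans mn | case/andP => /IA -> /IB ->].
Qed.

Lemma exists_vars_below (G : seq form) :
  exists n, forall A, A \in G -> vars_below n A.
Proof.
have one A : exists n, vars_below n A.
  elim: A => /= [i|A [m a] B [n b]|A [m a] B [n b]|A [m a] B [n b]|//];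
    first (by exists i.+1);
  by exists (maxn m n); rewrite (vars_below_le (leq_maxl _ _) a)
    (vars_below_le (leq_maxr _ _) b).
elim: G => [|A G [n IH]]; first by exists 0.
have [m Am] := one A; exists (maxn m n) => B.
rewrite inE => /predU1P [->|/IH]; first exact: vars_below_le (leq_maxl _ _) Am.
exact/vars_below_le/leq_maxr.
Qed.

Lemma invariant_subst C n s A :
  (forall p, p < n -> invariant C Bot (s p)) -> vars_below n A ->
  invariant C Bot (subst s A).
Proof.
move=> iv; have bot X : fle Bot X by move=> v k; rewrite force_Bot.
elim: A => [p /iv //|A IA B IB|A IA B IB|A IA B IB|A IA] /=.
- by case/andP => /IA a /IB; apply: invariant_And.
- by case/andP => /IA a /IB; apply: invariant_Or.
- by case/andP => /IA a /IB bb; have [] := definable_Imp a (conj (bot _) bb).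
- by move=> /IA; apply: invariant_Neg.
Qed.

Lemma eval_subst_below n (v : nat -> rn) s A :
  (forall p, p < n -> eval v (s p) = v p) -> vars_below n A ->
  eval v (subst s A) = eval v A.
Proof.
move=> h; elim: A => /= [p /h //|A IA B IB|A IA B IB|A IA B IB|A IA] /=;
  by [case/andP => /IA -> /IB -> | move/IA ->].
Qed.

(* The first condition makes the map to locations onto, so that validity at [v]
   is validity on the whole sum. *)
Definition fits C b v (P : seq nat) :=
  (forall i n, is_loc C i n -> exists k, at_loc C b i n v k) /\
  (forall p, p \in P -> exists2 A, definable C b A & eval v A = v p).

Lemma finite_choice n (R : nat -> form -> Prop) :
  (forall p, p < n -> exists A, R p A) ->
  exists s : nat -> form, forall p, p < n -> R p (s p).
Proof.
elim: n => [|n IH] h; first by exists Var.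
have [|s hs] := IH; first by move=> p pn; apply: h; lia.
have [A RA] := h n (leqnn _).
exists (fun p => if p == n then A else s p) => p.
by rewrite ltnS leq_eqVlt; case: eqP => [->|_ /hs].
Qed.

(** Let [s p] be a definable formula with value [v p]. Then [subst s A] agrees with [A] at [v] and
    is invariant; since [v] meets every location, its truth at [v] passes to any [v'], and back when
    [v'] meets them all. *)
Lemma fits_subst C n v : fits C Bot v (iota 0 n) ->
  exists s, forall A, vars_below n A ->
    (forall v', holds v A -> holds v' (subst s A)) /\
    (forall v' P, fits C Bot v' P -> holds v' (subst s A) -> holds v A).
Proof.
case=> surj dfn.
have [|s hs] :=
    @finite_choice n (fun p A => definable C Bot A /\ eval v A = v p).
  by move=> p pn; have [|A dA e] := dfn p; [rewrite mem_iota | exists A].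
exists s => A An.
have inv : invariant C Bot (subst s A).
  by apply: invariant_subst An => p /hs [[]].
have ev : eval v (subst s A) = eval v A.
  by apply: eval_subst_below An => p /hs [].
have vA : holds v A <-> holds v (subst s A) by rewrite /holds ev.
split=> [v' /vA/holdsP h|v' P [surj' _] /holdsP h]; last apply/vA;
  apply/holdsP => k.
  have [|i [m ak]] := @at_total C Bot v' k; first by rewrite force_Bot.
  have [k' ak'] := surj _ _ (at_is_loc ak).
  exact: inv ak' ak (h _).
have [|i [m ak]] := @at_total C Bot v k; first by rewrite force_Bot.
have [k' ak'] := surj' _ _ (at_is_loc ak).
exact: inv ak' ak (h _).
Qed.

Lemma fits_End b v P :
  (exists k, ~~ force v b k) -> (forall p, p \in P -> v p = RNtop) ->
  fits End b v P.
Proof.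
move=> [k nb] Ptop; split=> [i n /andP [/eqP -> /eqP ->]|p /Ptop ->].
  by exists k.
by exists Top; [exact: definable_Top | apply/holdsP; apply: force_Top].
Qed.

Lemma invariant_seg_Ladder d b m : invariant (Ladder d) b (seg b (raw d b) m).
Proof.
move=> i n v k v' k' /andP [_ bk] /andP [_ bk'].
by rewrite !(block_force (@raw_ge d b) _ bk) (block_force (@raw_ge d b) _ bk').
Qed.

Lemma definable_seg_Ladder d b m : definable (Ladder d) b (seg b (raw d b) m).
Proof.
split; last exact: invariant_seg_Ladder.
exact: (@seg_le _ _ (@raw_ge d b) 0).
Qed.

Lemma eval_seg v b g c n :
  eval v b = RNseg c -> eval v g = RNseg c.+1 ->
  eval v (seg b g n) = RNseg (c + n).
Proof.
move=> vb vg.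
suff [] : eval v (seg b g n) = RNseg (c + n) /\
          eval v (seg b g n.+1) = RNseg (c + n.+1) by [].
elim: n => [|n [IH IHS]]; first by rewrite addn0 addn1.
split=> //; rewrite segSS /= -/(seg b g n.+1).
by rewrite IHS IH !addnS -rn_gapE -rn_segE.
Qed.

Lemma fits_Ladder d b v P c :
  eval v b = RNseg c -> eval v (raw d b) = RNseg c.+1 ->
  (forall p, p \in P -> rn_le (RNseg c) (v p)) -> fits (Ladder d) b v P.
Proof.
move=> vb vd cP; split=> [i n /= /eqP ->|p /cP].
  (* The values of the [seg] formulas are [RNseg (c + n)], so block [n] is the single point
     [c + n]. *)
  exists (c + n); rewrite eqxx /block_at /force !(eval_seg _ vb vd) /=.
  by lia.
case: (v p) => [m|m|_] /=; last first.
  by exists Top; [exact: definable_Top | apply/holdsP; apply: force_Top].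
- move=> cm; set g := raw d b.
  exists (Imp (seg b g (m - c).+1) (seg b g (m - c))).
    apply: definable_Imp; last exact: definable_seg_Ladder.
    exact: invariant_seg_Ladder.
  rewrite -[LHS]/(himp (eval v (seg b g _.+1)) (eval v (seg b g _))).
  by rewrite !(eval_seg _ vb vd) addnS subnKC // rn_gapE.
- move=> cm; exists (seg b (raw d b) (m - c)).
    exact: definable_seg_Ladder.
  by rewrite (eval_seg _ vb vd) subnKC.
Qed.

(** * Prefixing an antichain to a linear sum *)

Lemma definable_Step two d C b A :
  definable C (next two d b) A -> definable (Step two d C) b A.
Proof.
move=> [geA iA]; split; first exact: fle_trans (@next_ge two d b) geA.
move=> [|i] n v k v' k'; last exact: iA.
move=> /andP [nt bk] /andP [_ bk'] _; apply: geA.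
by rewrite /next (block_force (@step_gen_ge two d b) _ bk').
Qed.

Lemma definable_seg_Step (two : bool) d C b m :
  m <= two.+1 -> definable (Step two d C) b (seg b (step_gen two d b) m).
Proof.
have bg := @step_gen_ge two d b.
move=> mt; split; first exact: (@seg_le _ _ bg 0 m).
move=> [|i] n v k v' k' /=.
  move=> /andP [_ bk] /andP [_ bk'].
  by rewrite !(block_force bg _ bk) (block_force bg _ bk').
move=> /at_notin /negP nf _ f; case: nf.
exact: seg_le f.
Qed.

Lemma fits_Step (two : bool) d C b v (P P' : seq nat) :
  fits C (next two d b) v P' ->
  (forall n, n <= two -> exists k, block_at v b (step_gen two d b) n k) ->
  (forall p, p \in P -> p \notin P' ->
     exists2 A, definable (Step two d C) b A & eval v A = v p) ->
  fits (Step two d C) b v P.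
Proof.
move=> [surj dfn] surj0 dfn0; split.
  case=> [|i] n /=; last exact: surj.
  by move=> nt; have [k bk] := surj0 n nt; exists k; rewrite nt.
move=> p Pp; case: (boolP (p \in P')) => [/dfn [A dA vA]|]; last exact: dfn0.
by exists A => //; apply: definable_Step.
Qed.

Section OneStep.
Variables (d : data) (b : form) (v : nat -> rn) (x : rn).
Hypotheses (vd : eval v (raw d b) = x)
  (dense : himp x (eval v b) = eval v b) (bx : (eval v b <= x)%O).

Lemma eval_next_one : eval v (next false d b) = x.
Proof. by rewrite /next /= vd dense join_l. Qed.

Lemma fits_one C (P P' : seq nat) :
  x != eval v b -> fits C (next false d b) v P' ->
  (forall p, p \in P -> p \notin P' -> v p = x) ->
  fits (Step false d C) b v P.
Proof.
move=> xb fC PP'; apply: (fits_Step fC) => [n|p Pp /(PP' p Pp) ->].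
  rewrite leqn0 => /eqP ->.
  have e := eval_next_one.
  apply: NNPP => nex; move/negP: xb; apply; apply/eqP/le_anti.
  rewrite bx andbT; apply/rn_leP => k; rewrite -e => xk.
  apply/negPn/negP => nb; apply: nex; exists k.
  by rewrite /block_at /force -/(next false d b) xk.
exists (next false d b); last exact: eval_next_one.
exact: definable_seg_Step.
Qed.

End OneStep.

Section TwoStep.
Variables (d : data) (b : form) (v : nat -> rn) (c : nat) (s : bool).
Hypotheses (vb : eval v b = RNseg c) (vd : eval v (raw d b) = RNgap (c + s)).

Lemma eval_gen_two : eval v (step_gen true d b) = RNgap (c + s).
Proof. by rewrite [LHS]/= vd vb !himp_gap negbK. Qed.

Lemma eval_gen_twoN : eval v (Imp (step_gen true d b) b) = RNgap (c + ~~ s).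
Proof.
rewrite -[LHS]/(himp (eval v (step_gen true d b)) (eval v b)) eval_gen_two vb.
exact: himp_gap.
Qed.

Lemma eval_next_two : eval v (next true d b) = RNseg c.+3.
Proof.
pose g := step_gen true d b.
rewrite -[LHS]/(eval v g `|` eval v (Imp g b))%O eval_gen_two eval_gen_twoN.
by case: s; rn_ext.
Qed.

Lemma fits_two C (P P' : seq nat) :
  fits C (next true d b) v P' ->
  (forall p, p \in P -> p \notin P' ->
     v p \in [:: RNseg c.+3; RNgap c; RNgap c.+1]) ->
  fits (Step true d C) b v P.
Proof.
have e1 := eval_gen_two; have e2 := eval_gen_twoN; have e3 := eval_next_two.
move=> fC PP'; apply: (fits_Step fC) => [n|p Pp /(PP' p Pp)].
  case: n => [|[|]] // _.
    (* Over [RNseg c], [RNgap c] adds only [c.+1], and [RNgap c.+1] adds [c] and [c.+2]; these last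
       two points share a block. *)
    exists (if s then c else c.+1); rewrite /block_at /force [seg _ _ 1]/=.
    by rewrite [seg _ _ 0]/= e1 vb /=; case: s => /=; lia.
  exists (if s then c.+1 else c); rewrite /block_at /force -/(next true d b).
  by rewrite [seg _ _ 1]/= e1 e3 /=; case: s => /=; lia.
have dg : definable (Step true d C) b (step_gen true d b).
  by apply: (@definable_seg_Step _ _ _ _ 1).
have dgN : definable (Step true d C) b (Imp (step_gen true d b) b).
  by case: dg => _ ig; apply: definable_Imp ig _; apply: definable_base.
rewrite !inE => /or3P [] /eqP ->.
- exists (next true d b) => //; exact: definable_seg_Step.
- case: (s) e1 e2 => /=; rewrite ?addn0 ?addn1 => e1 e2.
    by exists (Imp (step_gen true d b) b).
  by exists (step_gen true d b).
- case: (s) e1 e2 => /=; rewrite ?addn0 ?addn1 => e1 e2.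
    by exists (step_gen true d b).
  by exists (Imp (step_gen true d b) b).
Qed.

End TwoStep.

(** * The shape of a valuation *)

Fixpoint bounded (n m : nat) (C : code) : bool :=
  match C with
  | End => true
  | Ladder (_, p, q) => (p < n) && (q < n)
  | Step _ (_, p, q) C' =>
      if m is m'.+1 then [&& p < n, q < n & bounded n m' C'] else false
  end.

Lemma bounded_finite n m :
  exists L : seq code, forall C, bounded n m C -> C \in L.
Proof.
pose D : seq data := [seq (x, q) | x <- [seq (e, p) | e <- [:: true; false],
                        p <- iota 0 n], q <- iota 0 n].
have inD e p q : p < n -> q < n -> (e, p, q) \in D.
  move=> pn qn; apply: (allpairs_f pair); last by rewrite mem_iota.
  by apply: allpairs_f; [case: (e) | rewrite mem_iota].
elim: m => [|m [L IH]].
  exists (End :: map Ladder D) => -[|[[e p] q]|? [[? ?] ?] ? //] /=.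
    by rewrite mem_head.
  by case/andP => pn qn; rewrite inE map_f ?orbT //; apply: inD.
exists (End :: map Ladder D ++
  [seq Step true d C | d <- D, C <- L] ++
  [seq Step false d C | d <- D, C <- L]).
move=> [|[[e p] q]|two [[e p] q] C] /=; first by rewrite mem_head.
  by case/andP => pn qn; rewrite inE mem_cat map_f ?orbT //; apply: inD.
case/and3P => pn qn /IH CL; rewrite inE !mem_cat.
by case: two; rewrite (allpairs_f _ (inD e p q pn qn) CL) ?orbT.
Qed.

Lemma bounded_le n m m' C : m <= m' -> bounded n m C -> bounded n m' C.
Proof.
elim: C m m' => [|[[e p] q]|two [[e p] q] C IH] [|m] [|m'] //= mm.
by case/and3P => -> -> /IH ->.
Qed.

(* The two kinds of situation met after splitting off some summands, where [P]
   lists the variables not yet expressed.  In [stateI] the points left are the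
   ladder starting at [c].  In [stateII] there is moreover some point left above
   all points from [c] on, and each variable of [P] contains all points left
   that are smaller than [c]. *)
Definition stateI v b c (P : seq nat) := eval v b = RNseg c /\
  forall p, p \in P -> rn_le (RNseg c) (v p) && (v p != RNseg c).

Definition stateII v b c (P : seq nat) :=
  (exists2 c0, c0.+2 <= c & eval v b \in [:: RNseg c0; RNgap c0]) /\
  forall p, p \in P -> rn_le (RNseg c) (v p).

(* Twice the number of variables, since an intersection of two variables can
   serve as a border without expressing either of them. *)
Definition solvable n s := forall P v b c, size P <= s ->
  (forall p, p \in P -> p < n) -> stateI v b c P \/ stateII v b c P ->
  exists2 C, bounded n s.*2 C & fits C b v P.

Lemma size_filter_lt (a : pred nat) P q :
  q \in P -> ~~ a q -> size (filter a P) < size P.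
Proof.
move=> Pq naq; rewrite size_filter -(count_predC a P) -[X in X < _]addn0.
by rewrite ltn_add2l -has_count; apply/hasP; exists q.
Qed.

Lemma eval_rawP (v : nat -> rn) b p q :
  eval v (raw (false, p, q) b) = (v p `&` v q `|` eval v b)%O.
Proof. by []. Qed.

Lemma eval_rawN (v : nat -> rn) b p q :
  eval v (raw (true, p, q) b) =
  (himp (v p) (eval v b) `&` v q `|` eval v b)%O.
Proof. by []. Qed.

(** The value of [q] is [RNseg c.+1] or one of the gaps at [c] and [c.+1]. If [RNseg c.+1] is the
    value of a variable, or a meet of one with [q] or its complement, it generates the remaining
    ladder. Otherwise no variable separates [c] from [c.+2], and [c], [c.+1], [c.+2] collapse to a
    two-point summand. *)
Lemma stateI_solve n s P v b c q :
  solvable n s -> size P <= s.+1 -> (forall p, p \in P -> p < n) ->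
  stateI v b c P -> q \in P -> ~~ rn_le (RNseg c.+2) (v q) ->
  exists2 C, bounded n s.*2.+1 C & fits C b v P.
Proof.
move=> slv sP Pn [vb vP] Pq qc.
have cP p : p \in P -> rn_le (RNseg c) (v p) by case/vP/andP.
have ladder d : bounded n 0 (Ladder d) -> eval v (raw d b) = RNseg c.+1 ->
    exists2 C, bounded n s.*2.+1 C & fits C b v P.
  move=> bd vd; exists (Ladder d); first by case: d bd {vd} => [[]].
  exact: fits_Ladder vb vd cP.
case: (boolP (has (fun p => v p == RNseg c.+1) P)) => [/hasP [p Pp /eqP vp]|nP].
  apply: (ladder (false, p, p)); first by rewrite /= Pn.
  by rewrite eval_rawP vp vb; rn_ext.
have [e vq] : exists e : bool, v q = RNgap (c + e).
  move: (vP q Pq) qc (hasPn nP q Pq); case: (v q) => [m|m|] //=.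
    by rewrite !rn_eqE => *; exfalso; lia.
  move=> cm cm2 _; exists (m != c); congr RNgap; lia.
case: (boolP (has (fun p => v p \in [:: RNseg c.+2; RNgap c.+2]) P)).
  case/hasP => p Pp; rewrite !inE => vp.
  apply: (ladder (~~ e, q, p)); first by rewrite /= !Pn.
  case: e vq => vq; rewrite ?eval_rawP ?eval_rawN vq vb ?himp_gap;
    by case/orP: vp => /eqP ->; rn_ext.
move=> /hasPn nP2.
pose P' := [seq p <- P | v p \notin [:: RNseg c.+3; RNgap c; RNgap c.+1]].
have vd : eval v (raw (false, q, q) b) = RNgap (c + e).
  by rewrite eval_rawP vq vb; case: (e); rn_ext.
have sub p : p \in P' -> p \in P by rewrite mem_filter => /andP [].
have [|||C bC fC] := slv P' v (next true (false, q, q) b) c.+3.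
- rewrite -ltnS; apply: leq_trans sP; apply: (size_filter_lt Pq).
  by rewrite negbK vq !inE; case: (e); rewrite ?addn0 ?addn1 eqxx ?orbT.
- by move=> p /sub /Pn.
- left; split; first exact: eval_next_two vb vd.
  move=> p; rewrite mem_filter !inE !negb_or => /andP [+ Pp].
  move: (vP p Pp) (hasPn nP p Pp) (nP2 p Pp); rewrite !inE.
  by case: (v p) => [m|m|] //=; rewrite ?rn_eqE; lia.
exists (Step true (false, q, q) C); first by rewrite /= Pn.
apply: (fits_two vb vd fC) => p Pp; rewrite mem_filter Pp andbT.
by rewrite negbK.
Qed.

Definition first_missing (x : rn) : nat :=
  match x with RNseg m | RNgap m => m | RNtop => 0 end.

(** Let [m] be the least number missing from some variable. The points left with smaller numbers lie
    in every variable and collapse to one point. The new border is [RNseg m] if this is a variable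
    or a meet of two, and otherwise [RNgap m], which also absorbs [m.+1]. *)
Lemma stateII_solve n s P v b c :
  solvable n s -> size P <= s.+1 -> (forall p, p \in P -> p < n) ->
  stateII v b c P ->
  exists2 C, bounded n s.*2.+2 C & fits C b v P.
Proof.
move=> slv sP Pn [[c0 c0c vb] cP].
have nb : exists k, ~~ force v b k.
  exists c0; rewrite /force; move: vb; rewrite !inE => /orP [] /eqP -> /=; lia.
case: (boolP (all (fun p => v p == RNtop) P)) => [/allP vtop|ntop].
  by exists End => //; apply: fits_End => // p /vtop /eqP.
have [m [q Pq qm] minm] : exists2 m,
    (exists2 q, q \in P & v q \in [:: RNseg m; RNgap m]) &
    forall p, p \in P -> rn_le (RNseg m) (v p).
  have exm : exists m, has (fun q => v q \in [:: RNseg m; RNgap m]) P.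
    case/allPn: ntop => q Pq vq; exists (first_missing (v q)); apply/hasP.
    exists q => //.
    by case: (v q) vq => [m|m|] //= _; rewrite !inE eqxx ?orbT.
  case: (ex_minnP exm) => m /hasP [q Pq qm] minm; exists m; first by exists q.
  move=> p Pp; case E: (v p) => [l|l|] //=; apply: minm; apply/hasP;
    by exists p; rewrite // E !inE eqxx ?orbT.
have {c0c} c0m : c0.+2 <= m.
  have := cP q Pq; move: qm; rewrite !inE => /orP [] /eqP -> /=; lia.
have bm : rn_le (eval v b) (RNseg m).
  by move: vb; rewrite !inE => /orP [] /eqP -> /=; lia.
have step d x (P' : seq nat) : bounded n 1 (Step false d End) ->
    eval v (raw d b) = x -> x \in [:: RNseg m; RNgap m] ->
    (forall p, p \in P -> p \notin P' -> v p = x) ->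
    (eval v (next false d b) = x ->
      exists2 C, bounded n s.*2.+1 C & fits C (next false d b) v P') ->
    exists2 C, bounded n s.*2.+2 C & fits C b v P.
  move=> bd vd xm PP' ex.
  (* The point [c0] is in [x], not in the border, and above every point from [c0.+2] on, in
     particular from [m] on. *)
  have dense : himp x (eval v b) = eval v b.
    move: vb xm; rewrite !inE rn_impE /rn_imp.
    by case/orP => /eqP -> /orP [] /eqP -> /=; do 4?[case: ifP => //=]; lia.
  have bx : (eval v b <= x)%O.
    rewrite -[(_ <= _)%O]/(rn_le _ x).
    by move: vb xm; rewrite !inE; case/orP => /eqP -> /orP [] /eqP -> /=; lia.
  have xb : x != eval v b.
    apply/eqP => e; move: vb xm; rewrite e !inE.
    by case/orP => /eqP -> /orP [] /eqP [] //; lia.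
  have [C bC fC] := ex (eval_next_one vd dense bx).
  exists (Step false d C); last exact: (fits_one vd dense bx xb fC PP').
  case: d bd {vd ex fC} => [[? p0] q0] /and3P [pn qn _].
  exact/and3P.
case: (boolP (has (fun p => v p == RNseg m) P)) => [/hasP [p Pp /eqP vp]|nP].
  pose P' := [seq r <- P | v r != RNseg m].
  apply: (step (false, p, p) (RNseg m) P'); first by rewrite /= Pn.
  - by rewrite eval_rawP vp; move: bm; case: (eval v b) => [l|l|] //= ?; rn_ext.
  - by rewrite mem_head.
  - by move=> r Pr; rewrite mem_filter Pr andbT negbK => /eqP.
  move=> vn; have [|||C bC fC] := slv P' v (next false (false, p, p) b) m.
  - rewrite -ltnS; apply: leq_trans sP; apply: (size_filter_lt Pp).
    by rewrite vp eqxx.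
  - by move=> r; rewrite mem_filter => /andP [_ /Pn].
  - by left; split=> // r; rewrite mem_filter => /andP [-> /minm ->].
  by exists C => //; apply: bounded_le bC.
have {qm} vq : v q = RNgap m.
  by have := hasPn nP q Pq; move: qm; rewrite !inE => /orP [->|/eqP].
have ltP r : r \in P -> v r != RNgap m -> rn_le (RNseg m.+1) (v r).
  move=> Pr; move: (minm r Pr) (hasPn nP r Pr).
  by case: (v r) => [l|l|] //=; rewrite !rn_eqE; lia.
case: (boolP (has (fun p => v p \in [:: RNseg m.+1; RNgap m.+1]) P)).
  case/hasP => p Pp; rewrite !inE => vp.
  (* This step leaves [P] as it is; the next makes progress, because [q] cuts the ladder from [m] on
     near its top. *)
  apply: (step (false, q, p) (RNseg m) P); first by rewrite /= !Pn.
  - rewrite eval_rawP vq; move: bm; case: (eval v b) => [l|l|] //= ?;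
      by case/orP: vp => /eqP ->; rn_ext.
  - by rewrite mem_head.
  - by move=> r ->.
  move=> vn; apply: (@stateI_solve n s P v _ m q) => //; last first.
    by rewrite vq /=; lia.
  by split=> // r Pr; rewrite minm // (hasPn nP r Pr).
move=> nP2; pose P' := [seq r <- P | v r != RNgap m].
apply: (step (false, q, q) (RNgap m) P'); first by rewrite /= Pn.
- rewrite eval_rawP vq; move: vb bm; rewrite !inE.
  by move=> /orP [] /eqP -> /= ?; rn_ext.
- by rewrite !inE eqxx orbT.
- by move=> r Pr; rewrite mem_filter Pr andbT negbK => /eqP.
move=> vn; have [|||C bC fC] := slv P' v (next false (false, q, q) b) m.+2.
- rewrite -ltnS; apply: leq_trans sP; apply: (size_filter_lt Pq).
  by rewrite vq eqxx.
- by move=> r; rewrite mem_filter => /andP [_ /Pn].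
(* The point [m] is outside [RNgap m] and lies above all points from [m.+2] on. *)
- right; split; first by exists m; rewrite // vn !inE eqxx orbT.
  move=> r; rewrite mem_filter => /andP [nr Pr].
  move: (ltP r Pr nr) (hasPn nP2 r Pr); rewrite !inE.
  by case: (v r) => [l|l|] //=; rewrite ?rn_eqE; lia.
by exists C => //; apply: bounded_le bC.
Qed.

Lemma solvableP n s : solvable n s.
Proof.
elim: s => [|s slv] P v b c sP Pn st.
  have {sP} -> : P = [::] by apply/eqP; rewrite -size_eq0 -leqn0.
  exists End => //; apply: fits_End => //.
  case: st => [[vb _]|[[c0 _ vb] _]].
    by exists c; rewrite /force vb /= ltnn.
  exists c0; rewrite /force; move: vb.
  by rewrite !inE => /orP [] /eqP -> /=; lia.
rewrite doubleS.
case: st => [stI|stII]; last exact: stateII_solve slv sP Pn stII.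
case: (boolP (all (fun q => rn_le (RNseg c.+2) (v q)) P)) => [/allP cP|/allPn].
  (* No variable separates [c] from [c.+1], so [c] becomes the point left above all points from
     [c.+2] on. *)
  have [vb _] := stI; apply: (stateII_solve (c := c.+2) slv sP Pn).
  by split=> //; exists c; rewrite // vb mem_head.
case=> q Pq nq; have [C bC fC] := stateI_solve slv sP Pn stI Pq nq.
by exists C => //; apply: bounded_le bC.
Qed.

Lemma fits_exists n v :
  exists2 C, bounded n n.*2 C & fits C Bot v (iota 0 n).
Proof.
have vb : eval v Bot = RNseg 0.
  by apply: mem_inj => k; rewrite -/(force v Bot k) force_Bot.
(* Variables with value bottom are expressed by [Bot]; [stateI] requires values strictly above the
   border. *)
pose P := [seq p <- iota 0 n | v p != RNseg 0].
have [|||C bC [surj dfn]] := @solvableP n n P v Bot 0.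
- by rewrite size_filter (leq_trans (count_size _ _)) ?size_iota.
- by move=> p; rewrite mem_filter mem_iota => /and3P [].
- left; split=> // p; rewrite mem_filter => /andP [-> _].
  by case: (v p).
exists C => //; split=> // p np.
case: (eqVneq (v p) (RNseg 0)) => [->|vp]; last first.
  by apply: dfn; rewrite mem_filter vp.
by exists Bot => //; apply: definable_base.
Qed.

(** * Structural completeness of the extensions *)

Lemma extension_structurally_complete S :
  deductive_extension (structural_completion (logic_of rn)) S ->
  structurally_complete S.
Proof.
move=> ext [G A] adm; rewrite /derivable /=.
have [n Gn] := exists_vars_below (A :: G).
have thRN D : (forall v, holds v D) -> theorems S D.
  by move=> vD; apply/ext/valid_rule_derivable.
(* A code contributes a theorem to [T] only if some valuation fitting it refutes the rule. *)
have refuters (L : seq code) : exists2 T : seq form,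
    (forall D, D \in T -> theorems S D) &
    forall C v, C \in L -> fits C Bot v (iota 0 n) ->
      (forall B, B \in G -> holds v B) -> (forall D, D \in T -> holds v D) ->
      holds v A.
  elim: L => [|C L [T thT IH]]; first by exists [::].
  case: (classic (exists v, [/\ fits C Bot v (iota 0 n),
      forall B, B \in G -> holds v B & ~ holds v A])) => [|nex]; last first.
    exists T => // C' v; rewrite inE => /predU1P [->|]; last exact: IH.
    by move=> fv vG _; apply: NNPP => nA; apply: nex; exists v.
  case=> v [fv vG nA]; have [s hs] := fits_subst fv.
  exists (subst s A :: T).
    move=> D; rewrite inE => /predU1P [->|]; last exact: thT.
    apply: (admissible_subst (r := Rule G A) (s := s) adm) => D'.
    move=> /= /mapP [B GB ->]; apply: thRN => v'.
    have [|h _] := hs B; first by apply: Gn; rewrite inE GB orbT.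
    exact/h/vG.
  move=> C' v'; rewrite inE => /predU1P [->|CL] fv' vG' vT; last first.
    by apply: IH CL fv' vG' _ => D TD; apply: vT; rewrite inE TD orbT.
  have [_ h] := hs A (Gn A (mem_head _ _)).
  by case: nA; apply: h fv' _; apply: vT; apply: mem_head.
have [L inL] := bounded_finite n n.*2.
have [T thT hT] := refuters L.
(* The rule from [G ++ T] to [A] holds at every valuation, so the completion already derives it. *)
apply: (@derives_cut _ _ (G ++ T)).
  move=> B; rewrite mem_cat => /orP [/derives_premise //|/thT thB].
  by apply: (@derives_cut _ _ [::]).
apply/ext/valid_rule_derivable => v vGT.
have [C bC fC] := fits_exists n v.
apply: (hT C v (inL C bC) fC) => B BG; apply: vGT; rewrite mem_cat BG ?orbT //.
Qed.

Theorem proposition5p9 :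
  hereditarily_structurally_complete (structural_completion (logic_of rn)).
Proof.
by split=> [|S]; apply: extension_structurally_complete.
Qed.
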